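(* Let the autonomous system $\dot x=f(x)$ on $\mathbb R^{2N}$ be semi-contracting on a convex domain $\mathcal D\subseteq\mathbb R^{2N}$ with respect to $\|\cdot\|_R$ with rate $c>0$, with $\ker(R)$ infinitesimally invariant on $\mathcal D$. Let $x_c\in\mathcal D$ be a constant reference and define $r_{\mathrm{res}}:=\|f(x_c)\|_R$. For any radius $\bar r\ge r_{\mathrm{res}}/c$ let $$\mathcal T_{\bar r}(x_c):=\Big\{x\ :\ \inf_{v\in\ker(R)}\|x-(x_c+v)\|_R\le\bar r\Big\}.$$ Then any such $\mathcal T_{\bar r}(x_c)$ with $\mathcal T_{\bar r}(x_c)\subseteq\mathcal D$ is forward-invariant. Moreover, it contains an equilibrium manifold $x^*+\ker(R)$ satisfying $$\inf_{v\in\ker(R)}\|x_c-(x^*+v)\|_R\le\frac{r_{\mathrm{res}}}{c}.$$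
   Context: $N\ge2$. $R_\theta\in\mathbb R^{(N-1)\times N}$ has orthonormal rows spanning $\mathrm{span}\{\mathbf 1_N\}^\perp$; $R:=\mathrm{blkdiag}(R_\theta,I_N)\in\mathbb R^{(2N-1)\times2N}$; $\|x\|_R:=\|Rx\|_2$ is a seminorm on $\mathbb R^{2N}$ with kernel $\ker(R)=\mathrm{span}\{[\mathbf 1_N^\top,\mathbf 0_N^\top]^\top\}$. $f:\mathbb R^{2N}\to\mathbb R^{2N}$ is continuously differentiable with Jacobian $Df(x)$. For $A\in\mathbb R^{2N\times2N}$, $\|A\|_R:=\max\{\|Az\|_R: z\perp\ker(R),\ \|z\|_R=1\}$ and $\mu_R(A):=\lim_{h\to0^+}\frac{\|I+hA\|_R-1}{h}$, which equals $\lambda_{\max}\big(\tfrac12(RAR^\top+RA^\top R^\top)\big)$. The system is semi-contracting on the convex set $\mathcal D$ with rate $c>0$ with respect to $\|\cdot\|_R$ if $\mu_R(Df(x))\le -c$ for all $x\in\mathcal D$. The kernel is infinitesimally invariant on $\mathcal D$ if $Df(x)\ker(R)\subseteq\ker(R)$ for all $x\in\mathcal D$. A set $\mathcal T$ is forward-invariant if every solution with $x(0)\in\mathcal T$ satisfies $x(t)\in\mathcal T$ for all $t\ge0$ in its interval of existence. An equilibrium manifold is an affine line $x^*+\ker(R)$ of equilibria of the projected dynamics, i.e. $\|f(y)\|_R=0$ for every $y\in x^*+\ker(R)$ (equilibrium modulo a uniform rotation of the angles). *)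

(* Defs.v *)
From HB Require Import structures.
From mathcomp Require Import all_boot all_order all_algebra.
From mathcomp Require Import all_classical all_reals all_analysis.
Import Order.TTheory GRing.Theory Num.Theory.
Import numFieldNormedType.Exports.

Set Implicit Arguments.
Unset Strict Implicit.
Unset Printing Implicit Defensive.

Local Open Scope classical_set_scope.
Local Open Scope ring_scope.

(* The state space R^{2N} is 'cV[K]_(N + N): the first N coordinates are the
   angles.  The library topology on 'cV is the one of the sup norm, which is
   the usual topology; the Euclidean norm is norm2 below. *)

Definition norm2 (K : realType) (n : nat) (x : 'cV[K]_n) : K :=
  Num.sqrt (\sum_(i < n) x i 0 ^+ 2).

(* The rows of Rt are orthonormal and their span, as row vectors, is the set
   of all u with u *m 1_N = 0. *)
Definition orthonormal_complement_ones (K : realType) (N : nat)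
    (Rt : 'M[K]_(N.-1, N)) : Prop :=
  Rt *m Rt^T = 1%:M /\ (Rt == kermx (const_mx 1 : 'cV[K]_N))%MS.

Definition blkR (K : realType) (N : nat) (Rt : 'M[K]_(N.-1, N)) :
    'M[K]_(N.-1 + N, N + N) :=
  block_mx Rt 0 0 1%:M.

Section seminorm.
Context {K : realType} {m n : nat}.
Variable R : 'M[K]_(m, n).

Definition seminorm (x : 'cV[K]_n) : K := norm2 (R *m x).

Definition kerR : set 'cV[K]_n := [set z | R *m z = 0].

Definition orthogonal_to_kerR (z : 'cV[K]_n) : Prop :=
  forall v, kerR v -> z^T *m v = 0.

(* The supremum is a maximum: the set {z _|_ ker R, |z|_R = 1} is compact,
   and it is nonempty whenever R is nonzero. *)
Definition induced_seminorm (A : 'M[K]_n) : K :=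
  sup [set seminorm (A *m z) | z in
         [set z | orthogonal_to_kerR z /\ seminorm z = 1]].

Definition log_seminorm (A : 'M[K]_n) : K :=
  lim ((fun h : K => (induced_seminorm (1%:M + h *: A) - 1) / h) @ 0^'+).

End seminorm.

(* (Jac f x) i j is the partial derivative of f_i along the j-th coordinate;
   the library's jacobian is for maps of row vectors and is the transpose. *)
Definition Jac (K : realType) (n : nat) (f : 'cV[K]_n -> 'cV[K]_n)
    (x : 'cV[K]_n) : 'M[K]_n :=
  \matrix_(i, j) ('D_(delta_mx j 0) f x) i 0.

Definition continuously_differentiable (K : realType) (n : nat)
    (f : 'cV[K]_n -> 'cV[K]_n) : Prop :=
  (forall x, differentiable f x) /\ continuous (Jac f).

Definition semi_contracting (K : realType) (m n : nat) (R : 'M[K]_(m, n))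
    (f : 'cV[K]_n -> 'cV[K]_n) (D : set 'cV[K]_n) (c : K) : Prop :=
  forall x, D x -> log_seminorm R (Jac f x) <= - c.

Definition infinitesimally_invariant (K : realType) (m n : nat)
    (R : 'M[K]_(m, n)) (f : 'cV[K]_n -> 'cV[K]_n) (D : set 'cV[K]_n) : Prop :=
  forall x, D x -> [set Jac f x *m v | v in kerR R] `<=` kerR R.

(* x solves x' = f(x) on the interval J.  The derivative is taken within J,
   hence one-sided at an endpoint that belongs to J; the values of x outside J
   are irrelevant. *)
Definition solution_on (K : realType) (n : nat) (f : 'cV[K]_n -> 'cV[K]_n)
    (J : set K) (x : K -> 'cV[K]_n) : Prop :=
  forall t, J t ->
    h^-1 *: (x (t + h) - x t) @[h --> within [set h | J (t + h)] 0^'] --> f (x t).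

Definition forward_invariant (K : realType) (n : nat)
    (f : 'cV[K]_n -> 'cV[K]_n) (T : set 'cV[K]_n) : Prop :=
  forall (J : set K) (x : K -> 'cV[K]_n),
    is_interval J -> J 0 -> solution_on f J x ->
    T (x 0) -> forall t, J t -> 0 <= t -> T (x t).

(* The distance, measured by the seminorm, from x to the line y + ker R. *)
Definition dist_ker (K : realType) (m n : nat) (R : 'M[K]_(m, n))
    (x y : 'cV[K]_n) : K :=
  inf [set seminorm R (x - (y + v)) | v in kerR R].

Definition tube (K : realType) (m n : nat) (R : 'M[K]_(m, n))
    (xc : 'cV[K]_n) (r : K) : set 'cV[K]_n :=
  [set x | dist_ker R x xc <= r].

Definition ker_coset (K : realType) (m n : nat) (R : 'M[K]_(m, n))
    (x : 'cV[K]_n) : set 'cV[K]_n :=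
  [set x + v | v in kerR R].

(* Equilibria of the projected dynamics, i.e. modulo a uniform rotation of the
   angles. *)
Definition equilibrium_manifold (K : realType) (m n : nat) (R : 'M[K]_(m, n))
    (f : 'cV[K]_n -> 'cV[K]_n) (x : 'cV[K]_n) : Prop :=
  forall y, ker_coset R x y -> seminorm R (f y) = 0.

(* Main.v *)
Require Import Defs.
From HB Require Import structures.
From mathcomp Require Import all_boot all_order all_algebra.
From mathcomp Require Import all_classical all_reals all_analysis.
From mathcomp Require Import ring lra.
Import Order.TTheory GRing.Theory Num.Theory.
Import numFieldNormedType.Exports.

Local Open Scope classical_set_scope.
Local Open Scope ring_scope.

(* With [R R^T = 1], the tube is the preimage under [x |-> R (x - xc)] of the
   closed Euclidean ball of radius [rbar].  The quotient
   [(|1 + h A|_R - 1) / h] is nondecreasing in [h], so its limit at [0+] exists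
   and dominates [<w, R A R^T w>] for unit [w]: contraction with rate [c] says
   that the Jacobian of the projected field is at most [- c] on each vector.
   Integrating along radii and bounding the constant term by Cauchy-Schwarz,
   the projected field does not point outwards on a sphere of radius
   [r >= |f xc|_R / c].
   Invariance: no contraction is available outside the tube, but there the
   local Lipschitz constant [C] of [f] gives [U' <= 2 C (U - rbar^2)] for
   [U := |x - xc|_R^2], hence [U <= rbar^2] by Gronwall.
   Equilibrium: [|R f|^2] attains its minimum on the ball of radius
   [|f xc|_R / c], and the minimum is [0], as otherwise an inward perturbation
   of the projected field would be a descent direction. *)

(** * Euclidean inner product and norm on column vectors *)

Section euclidean.
Context {K : realType}.

Definition dotp {n} (u v : 'cV[K]_n) : K := \sum_(i < n) u i 0 * v i 0.

Lemma dotpC {n} (u v : 'cV[K]_n) : dotp u v = dotp v u.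
Proof. by apply: eq_bigr => i _; rewrite mulrC. Qed.

Lemma dotpDr {n} (u v w : 'cV[K]_n) : dotp u (v + w) = dotp u v + dotp u w.
Proof. by rewrite -big_split; apply: eq_bigr => i _; rewrite mxE mulrDr. Qed.

Lemma dotpZr {n} a (u v : 'cV[K]_n) : dotp u (a *: v) = a * dotp u v.
Proof. by rewrite mulr_sumr; apply: eq_bigr => i _; rewrite mxE mulrCA. Qed.

Lemma dotpDl {n} (u v w : 'cV[K]_n) : dotp (u + v) w = dotp u w + dotp v w.
Proof. by rewrite dotpC dotpDr !(dotpC w). Qed.

Lemma dotpZl {n} a (u v : 'cV[K]_n) : dotp (a *: u) v = a * dotp u v.
Proof. by rewrite dotpC dotpZr dotpC. Qed.

Lemma dotpNr {n} (u v : 'cV[K]_n) : dotp u (- v) = - dotp u v.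
Proof. by rewrite -scaleN1r dotpZr mulN1r. Qed.

Lemma dotpNl {n} (u v : 'cV[K]_n) : dotp (- u) v = - dotp u v.
Proof. by rewrite dotpC dotpNr dotpC. Qed.

Lemma dotp0l {n} (v : 'cV[K]_n) : dotp 0 v = 0.
Proof. by rewrite -(scale0r v) dotpZl mul0r. Qed.

Definition dotpE := (@dotpDl, @dotpDr, @dotpZl, @dotpZr, @dotpNl, @dotpNr).

Lemma dotp_mulmx {m n} (A : 'M[K]_(m, n)) u v :
  dotp u (A *m v) = dotp (A^T *m u) v.
Proof.
have E k (a b : 'cV[K]_k) : dotp a b = (a^T *m b) 0 0.
  by rewrite mxE; apply: eq_bigr => i _; rewrite mxE.
by rewrite !E trmx_mul trmxK mulmxA.
Qed.

Lemma dotp_ge0 {n} (u : 'cV[K]_n) : 0 <= dotp u u.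
Proof. by apply: sumr_ge0 => i _; rewrite -expr2 sqr_ge0. Qed.

Lemma dotp_eq0 {n} (u : 'cV[K]_n) : (dotp u u == 0) = (u == 0).
Proof.
apply/eqP/eqP => [|->]; last by rewrite dotp0l.
move/psumr_eq0P => H; apply/matrixP => i j; rewrite ord1 mxE.
apply/eqP; rewrite -(sqrf_eq0 (u i 0)) expr2 H// => k _.
by rewrite -expr2 sqr_ge0.
Qed.

Lemma norm2E {n} (u : 'cV[K]_n) : norm2 u = Num.sqrt (dotp u u).
Proof. by congr Num.sqrt; apply: eq_bigr => i _; rewrite expr2. Qed.

Lemma norm2_ge0 {n} (u : 'cV[K]_n) : 0 <= norm2 u.
Proof. exact: sqrtr_ge0. Qed.

Lemma norm2_sqr {n} (u : 'cV[K]_n) : norm2 u ^+ 2 = dotp u u.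
Proof. by rewrite norm2E sqr_sqrtr// dotp_ge0. Qed.

Lemma norm2_eq0 {n} (u : 'cV[K]_n) : (norm2 u == 0) = (u == 0).
Proof. by rewrite -dotp_eq0 -norm2_sqr sqrf_eq0. Qed.

Lemma norm2Z {n} a (u : 'cV[K]_n) : norm2 (a *: u) = `|a| * norm2 u.
Proof.
by rewrite !norm2E !dotpE mulrA -expr2 sqrtrM ?sqr_ge0// sqrtr_sqr.
Qed.

Lemma norm2_le {n} (u : 'cV[K]_n) (r : K) : 0 <= r ->
  (norm2 u <= r) = (dotp u u <= r ^+ 2).
Proof. by move=> r0; rewrite -norm2_sqr ler_sqr ?nnegrE ?norm2_ge0. Qed.

Lemma cauchy_schwarz {n} (u v : 'cV[K]_n) : dotp u v <= norm2 u * norm2 v.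
Proof.
have [->|v0] := eqVneq v 0; first by rewrite dotpC dotp0l mulr_ge0 ?norm2_ge0.
have vv : 0 < dotp v v by rewrite lt_def dotp_ge0 dotp_eq0 v0.
(* Division-free residual of [u] along [v]: its square is [|v|^2 (|u|^2 |v|^2 - <u, v>^2)]. *)
have := dotp_ge0 (dotp v v *: u - dotp u v *: v).
rewrite !dotpE (dotpC v u) => H.
apply: le_trans (ler_norm _) _.
rewrite -ler_sqr ?nnegrE ?mulr_ge0 ?norm2_ge0// exprMn !norm2_sqr.
by rewrite real_normK ?num_real// -(ler_pM2l vv); lra.
Qed.

Lemma norm2D {n} (u v : 'cV[K]_n) : norm2 (u + v) <= norm2 u + norm2 v.
Proof.
rewrite norm2_le ?addr_ge0 ?norm2_ge0// sqrrD !norm2_sqr !dotpE (dotpC v u).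
by have := cauchy_schwarz u v; lra.
Qed.

Definition frobenius2 {m n} (A : 'M[K]_(m, n)) : K :=
  \sum_(i < m) \sum_(j < n) A i j ^+ 2.

(** Cauchy-Schwarz on each row. The Frobenius bound is crude, but it is continuous in the entries,
    so it can be maximised over a compact set. *)
Lemma norm2_mulmx {m n} (A : 'M[K]_(m, n)) u :
  norm2 (A *m u) <= Num.sqrt (frobenius2 A) * norm2 u.
Proof.
have F0 : 0 <= frobenius2 A.
  by apply: sumr_ge0 => i _; apply: sumr_ge0 => j _; rewrite sqr_ge0.
rewrite norm2_le ?mulr_ge0 ?sqrtr_ge0 ?norm2_ge0//.
rewrite exprMn sqr_sqrtr// mulr_suml; apply: ler_sum => i _.
have -> : (A *m u) i 0 = dotp (row i A)^T u.
  by rewrite mxE; apply: eq_bigr => j _; rewrite !mxE.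
have -> : \sum_j A i j ^+ 2 = norm2 (row i A)^T ^+ 2.
  by rewrite norm2_sqr; apply: eq_bigr => j _; rewrite !mxE expr2.
rewrite -expr2 -exprMn -[leLHS]real_normK ?num_real//.
rewrite ler_sqr ?nnegrE ?mulr_ge0 ?norm2_ge0// ler_norml cauchy_schwarz andbT.
rewrite lerNl -dotpNl (le_trans (cauchy_schwarz _ _))//.
by rewrite -scaleN1r norm2Z normrN1 mul1r.
Qed.

End euclidean.

(** * The logarithmic seminorm as a bound on a quadratic form *)

Section log_seminorm.
Context {K : realType} {m n : nat} {R : 'M[K]_(m, n)}.
Hypothesis RRT : R *m R^T = 1%:M.

(** The residual [d] lies in [ker R], so it is orthogonal to [z], and also to the range of [R^T];
    hence [<d, d> = 0]. *)
Lemma orthogonal_to_kerRP (z : 'cV_n) : orthogonal_to_kerR R z -> z = R^T *m (R *m z).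
Proof.
move=> zker; set d := z - R^T *m (R *m z).
have Rd0 : R *m d = 0 by rewrite mulmxBr (mulmxA R R^T) RRT mul1mx subrr.
have zd0 : dotp z d = 0.
  have := zker _ Rd0; move/matrixP/(_ 0 0); rewrite !mxE => <-.
  by apply: eq_bigr => i _; rewrite !mxE.
apply/eqP; rewrite -subr_eq0 -/d -dotp_eq0 {1}/d dotpDl dotpNl zd0 sub0r oppr_eq0.
by rewrite dotpC dotp_mulmx trmxK Rd0 dotp0l.
Qed.

Lemma orthogonal_to_kerR_tr (w : 'cV_m) : orthogonal_to_kerR R (R^T *m w).
Proof. by move=> v Rv; rewrite trmx_mul trmxK -mulmxA Rv mulmx0. Qed.

Lemma mulmx_tr (w : 'cV_m) : R *m (R^T *m w) = w.
Proof. by rewrite mulmxA RRT mul1mx. Qed.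

Lemma norm2_tr (w : 'cV_m) : norm2 (R^T *m w) = norm2 w.
Proof. by rewrite !norm2E dotp_mulmx trmxK mulmx_tr. Qed.

Let sphere := [set z | orthogonal_to_kerR R z /\ seminorm R z = 1].

(** The set under [sup] must be bounded: on the sphere [z = R^T (R z)] has Euclidean norm 1, so the
    Frobenius norm of [R A] is a bound. *)
Lemma induced_seminorm_ub (A : 'M[K]_n) z : sphere z ->
  seminorm R (A *m z) <= induced_seminorm R A.
Proof.
move=> Sz; apply: ub_le_sup; last by exists z.
exists (Num.sqrt (frobenius2 (R *m A))) => _ [y [yker Ry] <-].
rewrite /seminorm mulmxA (le_trans (norm2_mulmx _ _))//.
by rewrite (orthogonal_to_kerRP _ yker) norm2_tr -/(seminorm R y) Ry mulr1.
Qed.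

(** By Cauchy-Schwarz, [1 + h <R z, R A z> = <R z, R (1 + h A) z>] is at most [|(1 + h A) z|_R]. *)
Lemma log_seminorm_quotient_ge (A : 'M[K]_n) z (h : K) : sphere z -> 0 < h ->
  dotp (R *m z) (R *m (A *m z)) <=
  (induced_seminorm R (1%:M + h *: A) - 1) / h.
Proof.
move=> Sz h0; rewrite ler_pdivlMr// lerBrDr.
apply: le_trans (induced_seminorm_ub _ _ Sz); case: Sz => _ Rz.
have := cauchy_schwarz (R *m z) (R *m ((1%:M + h *: A) *m z)).
rewrite -!/(seminorm R _) Rz mul1r; apply: le_trans.
rewrite mulmxDl mul1mx mulmxDr -scalemxAl -scalemxAr !dotpE -norm2_sqr.
by rewrite -/(seminorm R z) Rz expr1n addrC mulrC.
Qed.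

(* Convexity of the induced seminorm: [1 + h A] is the convex combination of
   [1] and [1 + k A] with weight [h / k]. *)
Lemma log_seminorm_quotient_ndecr (A : 'M[K]_n) z (h k : K) : sphere z ->
  0 < h -> h <= k ->
  (induced_seminorm R (1%:M + h *: A) - 1) / h <=
  (induced_seminorm R (1%:M + k *: A) - 1) / k.
Proof.
move=> Sz h0 hk; have k0 : 0 < k := lt_le_trans h0 hk.
rewrite ler_pdivrMr// lerBlDr; apply: ge_sup.
  by exists (seminorm R ((1%:M + h *: A) *m z)), z.
move=> _ [y Sy <-].
have hk0 : 0 <= h / k by rewrite divr_ge0// ltW.
have hk1 : h / k <= 1 by rewrite ler_pdivrMr// mul1r.
have -> : (1%:M + h *: A) *m y =
    (1 - h / k) *: y + (h / k) *: ((1%:M + k *: A) *m y).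
  rewrite !mulmxDl !mul1mx -!scalemxAl scalerDr scalerA divfK ?gt_eqF//.
  by rewrite addrA -scalerDl subrK scale1r.
rewrite /seminorm mulmxDr -!scalemxAr (le_trans (norm2D _ _))// !norm2Z.
rewrite !ger0_norm ?subr_ge0//.
have := induced_seminorm_ub (1%:M + k *: A) _ Sy; case: Sy => _.
rewrite /seminorm => -> H.
set X := induced_seminorm R _ in H *.
rewrite mulr1 (_ : (X - 1) / k * h + 1 = 1 - h / k + h / k * X); last by ring.
by rewrite lerD2l ler_wpM2l.
Qed.

(** The quotient is monotone and bounded below, so the [lim] in the definition is a genuine limit,
    namely the infimum over [h > 0], which inherits the lower bound. *)
Lemma log_seminorm_ge (A : 'M[K]_n) z : sphere z ->
  dotp (R *m z) (R *m (A *m z)) <= log_seminorm R A.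
Proof.
move=> Sz; set q := fun h : K => (induced_seminorm R (1%:M + h *: A) - 1) / h.
have lbq : lbound (q @` [set` `]0, +oo[]) (dotp (R *m z) (R *m (A *m z))).
  move=> _ [h + <-]; rewrite /= in_itv/= andbT.
  exact: log_seminorm_quotient_ge.
have : q h @[h --> 0^'+] --> inf (q @` [set` `]0, +oo[]).
  apply: nondecreasing_at_right_cvgr => //; last by eexists; exact: lbq.
  move=> h k; rewrite !in_itv/= !andbT => h0 _.
  exact: (log_seminorm_quotient_ndecr _ _ _ _ Sz).
rewrite /log_seminorm -/q => /cvg_lim -> //.
apply: lb_le_inf => //; exists (q 1), 1 => //=.
by rewrite in_itv/= ltr01.
Qed.

(** Homogeneous form of the previous bound, by normalising [R^T w]. Contraction enters the rest of
    the proof only through it. *)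
Lemma dotp_le_log_seminorm (A : 'M[K]_n) (w : 'cV_m) :
  dotp w (R *m (A *m (R^T *m w))) <= log_seminorm R A * dotp w w.
Proof.
have [->|w0] := eqVneq w 0; first by rewrite !dotp0l mulr0.
have wn0 : 0 < norm2 w by rewrite lt_def norm2_ge0 norm2_eq0 w0.
pose z := (norm2 w)^-1 *: (R^T *m w).
have Rz : R *m z = (norm2 w)^-1 *: w by rewrite -scalemxAr mulmx_tr.
have Sz : sphere z.
  split; last first.
    by rewrite /seminorm Rz norm2Z normfV ger0_norm ?norm2_ge0// mulVf// gt_eqF.
  by rewrite /z scalemxAr; exact: orthogonal_to_kerR_tr.
have := log_seminorm_ge A _ Sz; rewrite Rz -2!scalemxAr !dotpE mulrA -expr2 exprVn.
by rewrite norm2_sqr mulrC ler_pdivrMr// -norm2_sqr exprn_gt0.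
Qed.

End log_seminorm.

(** * Limits, derivatives and a mean value theorem for vector fields *)

Section matrix_calculus.
Context {K : realType}.

Lemma cvg_mx {T : Type} {m n : nat} (F : set_system T) {FF : Filter F}
    (M : T -> 'M[K]_(m, n)) (l : 'M[K]_(m, n)) :
  (forall i j, M x i j @[x --> F] --> l i j) -> M x @[x --> F] --> l.
Proof.
move=> H B [P Pl PB]; apply: (@filterS _ F _ [set x | forall i j, P i j (M x i j)]).
  by move=> x /PB.
apply: filter_forall => i; apply: filter_forall => j.
exact: (H i j _ (Pl i j)).
Qed.

Lemma cvg_coord {T : Type} {m n : nat} (F : set_system T) {FF : Filter F}
    (M : T -> 'M[K]_(m, n)) (l : 'M[K]_(m, n)) i j :
  M x @[x --> F] --> l -> M x i j @[x --> F] --> l i j.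
Proof.
move=> Ml; apply: (cvg_comp M (fun N => N i j) Ml); exact: coord_continuous.
Qed.

Lemma cvg_sum {T : Type} {I : finType} (F : set_system T) {FF : Filter F}
    (g : I -> T -> K) (l : I -> K) :
  (forall i, g i x @[x --> F] --> l i) ->
  \sum_i g i x @[x --> F] --> \sum_i l i.
Proof.
move=> gl; have -> : (fun x => \sum_i g i x) = \sum_i g i.
  by apply/funext => x; rewrite fct_sumE.
elim/big_ind2 : _ => [|f1 l1 f2 l2|i _]; [exact: cvg_cst|exact: cvgD|exact: gl].
Qed.

Lemma cvg_dotp {T : Type} {n : nat} (F : set_system T) {FF : Filter F}
    (u v : T -> 'cV[K]_n) (a b : 'cV[K]_n) :
  u x @[x --> F] --> a -> v x @[x --> F] --> b ->
  dotp (u x) (v x) @[x --> F] --> dotp a b.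
Proof.
by move=> ua vb; apply: cvg_sum => i; apply: cvgM; exact: cvg_coord.
Qed.

Lemma cvg_mulmx {T : Type} {m n : nat} (A : 'M[K]_(m, n)) (F : set_system T)
    {FF : Filter F} (u : T -> 'cV[K]_n) (a : 'cV[K]_n) :
  u x @[x --> F] --> a -> A *m u x @[x --> F] --> A *m a.
Proof.
move=> ua; apply: cvg_mx => i j; rewrite mxE.
under eq_fun do rewrite mxE.
by apply: cvg_sum => k; apply: cvgM; [exact: cvg_cst|exact: cvg_coord].
Qed.

Lemma cvg_affine {T : Type} {m n : nat} (A : 'M[K]_(m, n)) (b : 'cV[K]_m)
    (F : set_system T) {FF : Filter F} (u : T -> 'cV[K]_n) (a : 'cV[K]_n) :
  u x @[x --> F] --> a -> b + A *m u x @[x --> F] --> b + A *m a.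
Proof. by move=> ua; apply: cvgD; [exact: cvg_cst|exact: cvg_mulmx]. Qed.

Lemma cvg_frobenius2 {T : Type} {m n : nat} (F : set_system T) {FF : Filter F}
    (M : T -> 'M[K]_(m, n)) (l : 'M[K]_(m, n)) :
  M x @[x --> F] --> l -> frobenius2 (M x) @[x --> F] --> frobenius2 l.
Proof.
move=> Ml; apply: cvg_sum => i; apply: cvg_sum => j.
by rewrite expr2; under eq_fun do rewrite expr2; apply: cvgM; exact: cvg_coord.
Qed.

Lemma is_deriveP {V W : normedModType K} (f : V -> W) (t v : V) (l : W) :
  h^-1 *: (f (h *: v + t) - f t) @[h --> 0^'] --> l -> is_derive t v f l.
Proof. by move=> H; split; [apply/cvg_ex; exists l|exact: cvg_lim]. Qed.

Lemma is_derive_cvg {V W : normedModType K} (f : V -> W) (t v : V) (l : W) :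
  is_derive t v f l -> h^-1 *: (f (h *: v + t) - f t) @[h --> 0^'] --> l.
Proof. by case=> df <-; exact: df. Qed.

Lemma is_derive_mulmx {V : normedModType K} {m n : nat} (A : 'M[K]_(m, n))
    (u : V -> 'cV[K]_n) (t v : V) (du : 'cV[K]_n) :
  is_derive t v u du -> is_derive t v (fun x => A *m u x) (A *m du).
Proof.
move=> /is_derive_cvg H; apply: is_deriveP.
by under eq_fun do rewrite -mulmxBr scalemxAr; exact: cvg_mulmx.
Qed.

Lemma is_derive_coord {V : normedModType K} {m n : nat} (M : V -> 'M[K]_(m, n))
    (t v : V) (dM : 'M[K]_(m, n)) i j :
  is_derive t v M dM -> is_derive t v (fun x => M x i j) (dM i j).
Proof.
move=> /is_derive_cvg H; apply: is_deriveP.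
have -> : (fun h => h^-1 *: (M (h *: v + t) i j - M t i j)) =
    (fun h => (h^-1 *: (M (h *: v + t) - M t)) i j).
  by apply/funext => h; rewrite !mxE.
exact: cvg_coord.
Qed.

Lemma is_derive_dotp {V : normedModType K} {n : nat} (u w : V -> 'cV[K]_n)
    (t v : V) (du dw : 'cV[K]_n) :
  is_derive t v u du -> is_derive t v w dw ->
  is_derive t v (fun x => dotp (u x) (w x)) (dotp (u t) dw + dotp (w t) du).
Proof.
move=> udu wdw.
have -> : (fun x => dotp (u x) (w x)) =
    \sum_i ((fun x => u x i 0) * (fun x => w x i 0)).
  by apply/funext => x; rewrite fct_sumE.
rewrite -big_split; apply: is_derive_sum => i.
by apply: is_deriveM; exact: is_derive_coord.
Qed.

(** [Jac] records only partial derivatives; differentiability makes ['D_d f p] linear in [d], which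
    is then expanded in the standard basis. *)
Lemma derive_Jac {n : nat} (f : 'cV[K]_n -> 'cV[K]_n) (p d : 'cV[K]_n) :
  differentiable f p -> 'D_d f p = Jac f p *m d.
Proof.
move=> df; rewrite deriveE//.
have {1}-> : d = \sum_j d j 0 *: delta_mx j 0.
  by rewrite {1}(matrix_sum_delta d); apply: eq_bigr => j _; rewrite big_ord1.
rewrite linear_sum; apply/matrixP => i k; rewrite ord1 summxE mxE.
by apply: eq_bigr => j _; rewrite linearZ/= -deriveE// !mxE mulrC.
Qed.

Lemma is_derive_line {n : nat} (f : 'cV[K]_n -> 'cV[K]_n) (p d : 'cV[K]_n) (s : K) :
  differentiable f (p + s *: d) ->
  is_derive s 1 (fun s => f (p + s *: d)) (Jac f (p + s *: d) *m d).
Proof.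
move=> df; apply: is_deriveP; rewrite -derive_Jac//.
set q := p + s *: d.
rewrite [X in X @ _ --> _](_ : _ = fun h => h^-1 *: (f (h *: d + q) - f q)).
  exact: is_derive_cvg (derivableP (diff_derivable (v := d) df)).
apply/funext => h /=; congr (_ *: (f _ - _)).
by rewrite /q [h%:A]mulr1 scalerDl addrCA.
Qed.

(** Pairing with a fixed [u] reduces to a scalar function of [s]; the intermediate point depends on
    [u]. *)
Lemma mean_value_line {n : nat} (f : 'cV[K]_n -> 'cV[K]_n) (u p d : 'cV[K]_n) :
  (forall x, differentiable f x) ->
  exists2 s : K, 0 <= s <= 1 &
    dotp u (f (p + d) - f p) = dotp u (Jac f (p + s *: d) *m d).
Proof.
move=> df.
pose g (s : K) := dotp u (f (p + s *: d)).
have dg (s : K) : is_derive s 1 g (dotp u (Jac f (p + s *: d) *m d)).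
  have := is_derive_dotp _ _ _ _ _ _ (is_derive_cst u s 1)
    (is_derive_line f p d s (df _)).
  by rewrite (dotpC _ 0) dotp0l addr0.
have [] := @MVT_segment K g _ 0 1 ler01 (fun s _ => dg s).
  apply: derivable_within_continuous => s _; exact: ex_derive.
move=> s s01 E; exists s; first by move: s01; rewrite in_itv.
by move: E; rewrite /g scale1r scale0r addr0 subr0 mulr1 dotpDr dotpNr.
Qed.

End matrix_calculus.

(** * A one-sided Gronwall inequality *)

Section barrier.
Context {K : realType}.

(** If [U b > rho], let [t0] be the last time with [U <= rho]. On []t0, b[] the differential
    inequality applies, so [(U - rho) exp (- L t)] does not increase from its nonpositive value at
    [t0], a contradiction. *)
Lemma barrier (U U' : K -> K) (a b rho L : K) : a <= b ->
  {within `[a, b], continuous U} ->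
  (forall t, t \in `]a, b[%R -> is_derive t 1 U (U' t)) ->
  (forall t, t \in `]a, b[%R -> rho <= U t -> U' t <= L * (U t - rho)) ->
  U a <= rho -> U b <= rho.
Proof.
move=> ab cU dU U'le Ua; rewrite leNgt; apply/negP => Ub.
pose S := [set t | a <= t <= b /\ U t <= rho].
have hsS : has_sup S.
  split; first by exists a; split => //; rewrite lexx ab.
  by exists b => t [/andP[]].
pose t0 := sup S.
have at0 : a <= t0.
  by apply: (sup_upper_bound hsS); split => //; rewrite lexx ab.
have t0b : t0 <= b by apply: ge_sup; [case: hsS|move=> t [/andP[]]].
have Ut0 : U t0 <= rho.
  (* Otherwise [U > rho] near [t0], while [S] has points arbitrarily close to its supremum. *)
  rewrite leNgt; apply/negP => rhoU.
  have t0ab : t0 \in `[a, b]%R by rewrite in_itv/= at0.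
  have [e /= e0 He] : \forall t \near t0, t \in `[a, b]%R -> rho < U t.
    move/subspace_continuousP : cU => /(_ t0 t0ab).
    by move/(_ [set y | rho < y]); apply; exact: lt_nbhsr.
  have [t [tab Ut] t0t] := sup_adherent e0 hsS.
  suff : rho < U t by rewrite ltNge Ut.
  apply: (He t); [rewrite /=|by rewrite in_itv].
  rewrite ger0_norm; first by rewrite ltrBlDr -ltrBlDl.
  by rewrite subr_ge0; apply: (sup_upper_bound hsS).
have Ugt t : t0 < t -> t <= b -> rho < U t.
  move=> t0t tb; rewrite ltNge; apply/negP => Ut.
  suff : t <= t0 by rewrite leNgt t0t.
  apply: (sup_upper_bound hsS); split => //.
  by rewrite tb (le_trans at0)// ltW.
have sub t : t \in `]t0, b[%R -> t \in `]a, b[%R.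
  by rewrite !in_itv/= => /andP[t0t ->]; rewrite (le_lt_trans at0).
pose P t := (U t - rho) * expR (- L * t).
have dP (t : K) : t \in `]t0, b[%R ->
    is_derive t 1 P ((U' t - L * (U t - rho)) * expR (- L * t)).
  move=> /sub /dU dUt.
  have dm : is_derive t 1 ( *%R (- L)) (- L).
    rewrite -[X in is_derive _ _ _ X]mulr1.
    exact: (@is_deriveZ K K K id (- L) t 1 1).
  have dE := @is_derive1_comp K expR ( *%R (- L)) t _ _ (is_derive_expR _) dm.
  have dB := is_deriveB dUt (is_derive_cst rho t 1).
  apply: (is_derive_eq (is_deriveM dB dE)).
  by rewrite /= !fctE /GRing.scale/=; ring.
have cP : {within `[t0, b], continuous P}.
  have cU0 : {within `[t0, b], continuous U}.
    apply: continuous_subspaceW cU; apply: subset_itvr; exact: at0.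
  move=> t; apply: cvgM; first by apply: cvgB; [exact: cU0|exact: cvg_cst].
  apply: continuous_subspaceT => {}t.
  apply: continuous_comp; last exact: continuous_expR.
  by apply: cvgM; [exact: cvg_cst|exact: cvg_id].
have := @ler0_derive1_le_cc K P t0 b _ _ cP b t0.
rewrite !in_itv/= !lexx t0b => /(_ _ _ isT isT isT) PP.
have : P b <= P t0.
  apply: PP => t tb; first by case: (dP t tb).
  rewrite derive1E (@derive_val _ _ _ _ _ _ _ (dP t tb)) pmulr_lle0 ?expR_gt0//.
  rewrite subr_le0; apply: U'le; first exact: sub.
  by move: tb; rewrite in_itv/= => /andP[/Ugt + /ltW tb] => /(_ tb)/ltW.
rewrite leNgt; apply/negP; rewrite negbK; apply: (@le_lt_trans _ _ 0).
  by rewrite pmulr_lle0 ?expR_gt0// subr_le0.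
by rewrite mulr_gt0 ?expR_gt0// subr_gt0.
Qed.

End barrier.

(** * Continuity and differentiability of solutions *)

Section trajectories.
Context {K : realType} {n : nat}.
Variables (f : 'cV[K]_n -> 'cV[K]_n) (J : set K) (x : K -> 'cV[K]_n).
Hypothesis solx : solution_on f J x.

(** [x (t + h)] is [x t] plus [h] times a convergent difference quotient. That limit is punctured,
    so [s = t] is treated apart. *)
Lemma solution_within_cvg (t : K) : J t -> x @ within J (nbhs t) --> x t.
Proof.
move=> Jt.
have xh : x (t + h) @[h --> within [set h | J (t + h)] 0^'] --> x t.
  have : h *: (h^-1 *: (x (t + h) - x t)) + x t
      @[h --> within [set h | J (t + h)] 0^'] --> 0 *: f (x t) + x t.
    apply: cvgD; last exact: cvg_cst.
    apply: cvgZ; last exact: solx.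
    apply: cvg_within_filter; exact: nbhs_dnbhs.
  rewrite scale0r add0r; apply: cvg_trans; apply: near_eq_cvg.
  rewrite /prop_near1/= /within/=.
  have : \forall h \near (0 : K)^', h != 0 by exact: nbhs_dnbhs_neq.
  by apply: filterS => h h0 _; rewrite scalerA divff// scale1r subrK.
move=> A xtA; have := xh A xtA; rewrite /nbhs/= /within/=.
case=> e /= e0 He; exists e => //= s ts Js.
have [->|st] := eqVneq s t; first exact: nbhs_singleton.
have := He (s - t); rewrite [t + _]addrC. rewrite subrK; apply => //.
  by rewrite /ball_ /= sub0r normrN -normrN opprB.
by rewrite subr_eq0.
Qed.

(** At an interior point of [J] the restriction to [J (t + h)] holds for all small [h], so the limit
    is two-sided. *)
Lemma solution_is_derive (t : K) : (\forall s \near t, J s) ->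
  is_derive t 1 x (f (x t)).
Proof.
move=> Jt; apply: is_deriveP.
have Jh : \forall h \near (0 : K)^', J (t + h).
  apply: nbhs_dnbhs; case/nbhs_ballP: (Jt) => e /= e0 He.
  apply/nbhs_ballP; exists e => //= h; rewrite /ball/= sub0r => he.
  by apply: He; rewrite /ball/= opprD addNKr.
have := solx t (nbhs_singleton Jt).
rewrite [X in _ -> X @ _ --> _](_ : _ = fun h => h^-1 *: (x (t + h) - x t)).
  move=> + A fA => /(_ A fA); rewrite /nbhs/= /within/=.
  by apply: filterS2 Jh => h Jh; exact.
by apply/funext => h; rewrite [h%:A]mulr1 (addrC h).
Qed.

End trajectories.

(** * The tube as a ball for the seminorm, and compactness of Euclidean balls *)

Section tube.
Context {K : realType} {m n : nat} (R : 'M[K]_(m, n)).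

(** The seminorm is blind to [ker R], so the infimum is over a singleton. *)
Lemma dist_kerE (x y : 'cV[K]_n) : dist_ker R x y = seminorm R (x - y).
Proof.
rewrite /dist_ker [X in inf X](_ : _ = [set seminorm R (x - y)]) ?inf1//.
apply/seteqP; split => [_ [v Rv <-]|_ ->]; last first.
  by exists 0; rewrite ?addr0//= /kerR/= mulmx0.
by rewrite /seminorm /= !mulmxBr mulmxDr (Rv : R *m v = 0) addr0.
Qed.

Lemma tubeE (xc : 'cV[K]_n) r x : tube R xc r x = (seminorm R (x - xc) <= r).
Proof. by rewrite /tube/= dist_kerE. Qed.

End tube.

(** The ball is closed in the cube of side [2 r], which is the transpose of a product of compact
    segments. *)
Lemma compact_norm2_ball {K : realType} {n : nat} (r : K) :
  compact [set u : 'cV[K]_n | norm2 u <= r].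
Proof.
have [r0|r0] := ltP r 0.
  rewrite (_ : [set _ | _] = set0); first exact: compact0.
  apply/seteqP; split => // u /=.
  by rewrite leNgt (lt_le_trans r0)// norm2_ge0.
have cbox : compact ((@trmx K 1 n) @`
    [set v : 'rV[K]_n | forall i, v ord0 i \in `[- r, r]]).
  apply: continuous_compact.
    apply: continuous_subspaceT => v.
    apply: (@cvg_mx _ _ _ _ (nbhs v)) => i j; rewrite mxE.
    under eq_fun do rewrite mxE; exact: coord_continuous.
  by apply: (@rV_compact _ _ (fun=> `[- r, r]%classic)) => i; exact: segment_compact.
apply: subclosed_compact cbox _.
  have -> : [set u : 'cV[K]_n | norm2 u <= r] =
      (fun u => dotp u u) @^-1` [set y | y <= r ^+ 2].
    by apply/funext => u /=; rewrite norm2_le.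
  apply: closed_comp; last exact: closed_le.
  by move=> u _; apply: (@cvg_dotp _ _ _ (nbhs u)); exact: cvg_id.
move=> u /= ur; exists u^T; last by rewrite trmxK.
move=> i; rewrite in_itv/= -ler_norml mxE.
rewrite -(@ler_sqr K) ?nnegrE// real_normK ?num_real//.
move: ur; rewrite norm2_le//; apply: le_trans.
rewrite /dotp (bigD1 i)//= -expr2 lerDl; apply: sumr_ge0 => k _.
by rewrite -expr2 sqr_ge0.
Qed.

(** * The projected field: equilibrium and forward invariance *)

Section contraction.
Context {K : realType} {m n : nat} {R : 'M[K]_(m, n)}.
Hypothesis RRT : R *m R^T = 1%:M.
Variable f : 'cV[K]_n -> 'cV[K]_n.
Hypothesis hf : continuously_differentiable f.
Variables (c rbar : K) (xc : 'cV[K]_n).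
Hypothesis c_gt0 : 0 < c.
Hypothesis contr : semi_contracting R f (tube R xc rbar) c.
Hypothesis inv : infinitesimally_invariant R f (tube R xc rbar).
Hypothesis rbar_ge : seminorm R (f xc) / c <= rbar.

Let df x : differentiable f x := hf.1 x.

Let rbar_ge0 : 0 <= rbar.
Proof. by apply: le_trans rbar_ge; rewrite divr_ge0 ?norm2_ge0// ltW. Qed.

Lemma tube_addZ p y s (w : 'cV[K]_m) : 0 <= s <= 1 -> R *m (y - xc) = 0 ->
  p = y + s *: (R^T *m w) -> norm2 w <= rbar -> tube R xc rbar p.
Proof.
move=> /andP[s0 s1] Ry -> wr; rewrite tubeE /seminorm addrAC mulmxDr Ry add0r.
rewrite -scalemxAr (mulmx_tr RRT) norm2Z ger0_norm//.
by rewrite (le_trans _ wr)// ler_piMl// norm2_ge0.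
Qed.

(** Infinitesimal invariance integrated along [v]: [|e|^2] equals [<e, R (Jac f) v>] at a point of
    the segment, which stays in the tube, and [R (Jac f) v = 0] there. *)
Lemma projected_kernel_invariant y v : tube R xc rbar y -> R *m v = 0 ->
  R *m f (y + v) = R *m f y.
Proof.
move=> Ty Rv; apply/eqP; rewrite -subr_eq0 -mulmxBr; set e := R *m _.
have [s _ E] := mean_value_line f (R^T *m e) y v df.
move: E; rewrite -dotp_mulmx -/e => E; rewrite -dotp_eq0 E -dotp_mulmx.
have -> : R *m (Jac f (y + s *: v) *m v) = 0.
  apply: (inv (y + s *: v)); last by exists v.
  move: Ty; rewrite !tubeE /seminorm (addrAC y) (mulmxDr _ (y - xc)).
  by rewrite -scalemxAr Rv scaler0 addr0.
by rewrite dotpC dotp0l.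
Qed.

(* With [w] a unit vector, this bounds the radial component of the projected
   field at distance [s] from the axis of the tube. *)
Lemma radial_field_le y s (w : 'cV[K]_m) :
  R *m (y - xc) = 0 -> 0 <= s -> norm2 (s *: w) <= rbar ->
  dotp w (R *m f (y + s *: (R^T *m w))) <=
  - c * (s * dotp w w) + dotp w (R *m f xc).
Proof.
move=> Ry s0 swr.
have -> : R *m f xc = R *m f y.
  rewrite -{1}(subrK xc y) [X in _ = R *m f X]addrC projected_kernel_invariant//.
  by rewrite tubeE subrr /seminorm mulmx0 norm2E dotp0l sqrtr0.
rewrite -lerBlDr -dotpNr -dotpDr -mulmxBr dotp_mulmx.
have [t t01 ->] := mean_value_line f (R^T *m w) y (s *: (R^T *m w)) df.
rewrite -dotp_mulmx -scalemxAr -scalemxAr dotpZr mulrCA ler_wpM2l//.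
apply: le_trans (dotp_le_log_seminorm RRT _ w) _.
rewrite ler_wpM2r ?dotp_ge0//; apply: contr.
by apply: (tube_addZ _ y t (s *: w)); rewrite // scalemxAr.
Qed.

(* The minimizer [w] of [|G|^2] over the ball of radius [r0], where
   [G w := R f (xc + R^T w)], is a zero of [G]: otherwise [u := G w - e w]
   with [e > 0] small is a descent direction, and it does not leave the ball
   because [<w, G w> <= 0] on its boundary. *)
Lemma projected_equilibrium_exists :
  exists2 w : 'cV[K]_m, norm2 w <= seminorm R (f xc) / c &
    R *m f (xc + R^T *m w) = 0.
Proof.
set r0 := seminorm R (f xc) / c.
have r0_ge0 : 0 <= r0 by rewrite divr_ge0 ?norm2_ge0// ltW.
have Rfxc : norm2 (R *m f xc) = c * r0 by rewrite mulrC divfK// gt_eqF.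
pose G w := R *m f (xc + R^T *m w).
have Gc : {within [set w : 'cV[K]_m | norm2 w <= r0],
    continuous (fun w => dotp (G w) (G w))}.
  apply: continuous_subspaceT => w.
  have lin : xc + R^T *m v @[v --> w] --> xc + R^T *m w.
    exact: (@cvg_affine _ _ _ _ _ _ (nbhs w) _ id).
  have Gw : G v @[v --> w] --> G w.
    apply: (@cvg_mulmx _ _ _ _ R (nbhs w)).
    exact: (cvg_comp _ f lin (differentiable_continuous (df _))).
  exact: (@cvg_dotp _ _ _ (nbhs w)).
have B0 : [set w : 'cV[K]_m | norm2 w <= r0] !=set0.
  by exists 0; rewrite /= norm2E dotp0l sqrtr0.
have [w wr Gmin] := compact_EVT_min B0 (compact_norm2_ball r0) Gc.
move: wr; rewrite inE/= => wr; exists w => //.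
apply/eqP; apply: contraT => Gw0; exfalso.
set p := R *m _ in Gw0.
have pp : 0 < dotp p p by rewrite lt_def dotp_ge0 dotp_eq0 Gw0.
set x := xc + R^T *m w in p Gw0 pp.
have Tx : tube R xc rbar x.
  rewrite tubeE /seminorm addrAC subrr add0r (mulmx_tr RRT).
  exact: le_trans rbar_ge.
pose M (v : 'cV[K]_m) := R *m (Jac f x *m (R^T *m v)).
have Mp : dotp p (M p) <= - c * dotp p p.
  apply: le_trans (dotp_le_log_seminorm RRT _ p) _.
  by rewrite ler_wpM2r ?dotp_ge0//; exact: contr.
set a := dotp p (M w).
(* Chosen so that [<p, M u> <= - c |p|^2 + e |a| = - e < 0]. *)
pose e := c * dotp p p / (1 + `|a|).
have a1 : 0 < 1 + `|a| by rewrite ltr_wpDr.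
have e_gt0 : 0 < e by rewrite divr_gt0// mulr_gt0.
have [u uE] : exists u, u = p - e *: w by eexists.
have pMu : dotp p (M u) < 0.
  have -> : dotp p (M u) = dotp p (M p) - e * a.
    by rewrite /M uE !mulmxBr -!scalemxAr dotpDr dotpNr dotpZr.
  have ea : e * (1 + `|a|) = c * dotp p p by rewrite divfK// gt_eqF.
  have : - (e * a) <= e * `|a|.
    by rewrite -mulrN ler_wpM2l ?(ltW e_gt0)// -normrN ler_norm.
  lra.
(* The right-hand side is [c |w| (r0 - |w|)], which vanishes on the boundary of the ball. *)
have wp : dotp w p <= - c * dotp w w + r0 * norm2 w * c.
  have := radial_field_le xc 1 w.
  rewrite subrr mulmx0 !scale1r mul1r => /(_ erefl ler01 (le_trans wr rbar_ge)).
  move/le_trans; apply; rewrite lerD2l (le_trans (cauchy_schwarz _ _))//.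
  by rewrite Rfxc [leRHS]mulrC mulrCA (mulrC (norm2 w)) mulrA lexx.
(* In the interior continuity suffices. On the boundary [<w, u> <= - e r0^2 < 0]: the term [- e w]
   in [u] makes the inequality strict. *)
have inball : \forall h \near (0 : K)^'+, norm2 (w + h *: u) <= r0.
  have wE h : dotp (w + h *: u) (w + h *: u) =
      dotp w w + h * (2 * dotp w u + h * dotp u u).
    by rewrite !dotpE (dotpC u w); ring.
  have [wr'|wr'] := ltP (dotp w w) (r0 ^+ 2).
    have : dotp w w + h * (2 * dotp w u + h * dotp u u) @[h --> (0 : K)] -->
        dotp w w + 0 * (2 * dotp w u + 0 * dotp u u).
      apply: cvgD; first exact: cvg_cst.
      apply: cvgM; first exact: cvg_id.
      apply: cvgD; first exact: cvg_cst.
      by apply: cvgM; [exact: cvg_id|exact: cvg_cst].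
    rewrite mul0r addr0 => /cvg_at_right_filter/cvgr_lt /(_ _ wr') H.
    near=> h; rewrite norm2_le// wE ltW//.
    by near: h; exact: H.
  have ww : norm2 w = r0.
    apply/eqP; rewrite eq_le wr -ler_sqr ?nnegrE ?norm2_ge0//.
    by rewrite norm2_sqr.
  (* For [r0 = 0] the point [x] is [xc], where the projected field has norm [c r0 = 0], against
     [p != 0]. *)
  have r0_gt0 : 0 < r0.
    rewrite lt_def r0_ge0 andbT; apply: contra Gw0 => /eqP r00.
    have w0 : w = 0 by apply/eqP; rewrite -norm2_eq0 ww r00.
    by rewrite -norm2_eq0 /p /x w0 mulmx0 addr0 Rfxc r00 mulr0.
  have wu : 2 * dotp w u < 0.
    rewrite uE dotpDr dotpNr dotpZr pmulr_rlt0//.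
    move: wp; rewrite -norm2_sqr ww.
    have : 0 < e * r0 ^+ 2 by rewrite mulr_gt0// exprn_gt0.
    lra.
  have : 2 * dotp w u + h * dotp u u @[h --> (0 : K)] -->
      2 * dotp w u + 0 * dotp u u.
    apply: cvgD; first exact: cvg_cst.
    by apply: cvgM; [exact: cvg_id|exact: cvg_cst].
  rewrite mul0r addr0 => /cvg_at_right_filter/cvgr_lt /(_ _ wu) H.
  near=> h; rewrite norm2_le// wE -norm2_sqr ww gerDl pmulr_rle0//.
  by apply: ltW; near: h; exact: H.
(* [g] has derivative [2 <p, M u> < 0] at 0, so it drops below [g 0] for small [h > 0], against
   minimality. *)
pose g (h : K) := dotp (R *m f (x + h *: (R^T *m u))) (R *m f (x + h *: (R^T *m u))).
have dg : is_derive (0 : K) 1 g (dotp p (M u) + dotp p (M u)).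
  have := is_derive_line f x (R^T *m u) 0 (df _).
  move/(is_derive_mulmx R) => dR; have := is_derive_dotp _ _ _ _ _ _ dR dR.
  by rewrite scale0r addr0.
have dg0 : dotp p (M u) + dotp p (M u) < 0 by rewrite -mulr2n pmulrn_llt0.
have := is_derive_cvg _ _ _ _ dg => /cvg_dnbhs_at_right/cvgr_lt /(_ _ dg0) H.
near (0 : K)^'+ => h.
have h0 : 0 < h by near: h; exact: nbhs_right_gt.
have : g h < g 0.
  have : h^-1 *: (g (h *: 1 + 0) - g 0) < 0 by near: h; exact: H.
  by rewrite addr0 [h *: 1]mulr1 /GRing.scale/= pmulr_rlt0 ?invr_gt0// subr_lt0.
rewrite ltNge => /negP; apply.
have := Gmin (w + h *: u).
rewrite inE/= /G mulmxDr addrA -/x -scalemxAr /g scale0r addr0; apply.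
by near: h; exact: inball.
Unshelve. all: by end_near. Qed.

(* Outside the tube, the projected field is compared with its value at the
   radial projection of [p] onto the tube, where it does not point outwards. *)
Lemma outward_velocity_le (p : 'cV[K]_n) (C : K) :
  let w := R *m (p - xc) in
  rbar <= norm2 w ->
  (forall s : K, 0 <= s <= 1 ->
    Num.sqrt (frobenius2 (Jac f (p - s *: (R^T *m w)))) <= C) ->
  dotp w (R *m f p) <= C * (dotp w w - rbar ^+ 2).
Proof.
move=> w rw JC.
have C0 : 0 <= C.
  by apply: le_trans (JC 0 _); rewrite ?sqrtr_ge0// lexx ler01.
have [w0|w0] := eqVneq (norm2 w) 0.
  have -> : rbar = 0 by apply/eqP; rewrite eq_le rbar_ge0 -w0 rw.
  by rewrite -norm2_sqr w0 expr0n subrr mulr0 (eqP (_ : w == 0)) ?dotp0l// -norm2_eq0 w0.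
have w_gt0 : 0 < norm2 w by rewrite lt_def w0 norm2_ge0.
set o := norm2 w in rw w0 w_gt0.
have wo : dotp w w = o ^+ 2 by rewrite norm2_sqr.
pose u := R^T *m w.
(* [y := p - u] is on the axis of the tube, and [y + s u] is the radial projection of [p], at
   distance [rbar]. *)
pose s := rbar / o.
have s0 : 0 <= s by rewrite divr_ge0// ltW.
have s1 : s <= 1 by rewrite ler_pdivrMr// mul1r.
have so : s * o = rbar by rewrite divfK.
have [y yE] : exists y, y = p - u by eexists.
have Ry : R *m (y - xc) = 0.
  by rewrite yE addrAC mulmxBr (mulmx_tr RRT) subrr.
have swr : norm2 (s *: w) <= rbar by rewrite norm2Z ger0_norm// so.
(* The contraction term is [- c rbar o], and the constant term is at most
   [o |R f xc| <= c rbar o]. *)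
have inner : dotp w (R *m f (y + s *: u)) <= 0.
  apply: le_trans (radial_field_le y s w Ry s0 swr) _.
  have := cauchy_schwarz w (R *m f xc); rewrite -/o.
  have : norm2 (R *m f xc) <= c * rbar by rewrite mulrC -ler_pdivrMr.
  rewrite wo expr2 (mulrA s) so => H1 H2.
  have := ler_wpM2l (ltW w_gt0) H1; nra.
have [t /andP[t0 t1] E] := mean_value_line f u (y + s *: u) ((1 - s) *: u) df.
have Ep : y + s *: u + (1 - s) *: u = p.
  by rewrite -addrA -scalerDl (addrC s) subrK scale1r yE subrK.
(* The intermediate point lies on the segment from [p] to the axis, where [JC] bounds the
   Jacobian. *)
have Eq : y + s *: u + t *: ((1 - s) *: u) = p - ((1 - t) * (1 - s)) *: u.
  rewrite scalerA (_ : t * (1 - s) = (1 - s) - (1 - t) * (1 - s)); last by ring.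
  by rewrite scalerBl addrA Ep.
rewrite Ep Eq -scalemxAr dotpZr dotpDr dotpNr -!dotp_mulmx in E.
have JCt := JC ((1 - t) * (1 - s)) _.
set Jt := Jac f _ in E JCt.
have Jtu : dotp w (R *m (Jt *m u)) <= C * o ^+ 2.
  rewrite dotp_mulmx -/u (le_trans (cauchy_schwarz _ _))//.
  apply: le_trans (ler_wpM2l (norm2_ge0 _) (norm2_mulmx _ _)) _.
  rewrite /u (norm2_tr RRT) -/o mulrCA -expr2 ler_wpM2r ?sqr_ge0//.
  apply: JCt; rewrite mulr_ge0 ?subr_ge0//= mulr_ile1 ?subr_ge0//.
    by rewrite lerBlDr lerDl.
  by rewrite lerBlDr lerDl.
have -> : dotp w (R *m f p) =
    dotp w (R *m f (y + s *: u)) + (1 - s) * dotp w (R *m (Jt *m u)).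
  by rewrite -E addrC subrK.
rewrite wo -(add0r (C * _)); apply: lerD => //.
(* Here [s o^2 = rbar o >= rbar^2], hence [(1 - s) o^2 <= o^2 - rbar^2]. *)
apply: (@le_trans _ _ ((1 - s) * (C * o ^+ 2))).
  by rewrite ler_wpM2l// subr_ge0.
rewrite mulrCA ler_wpM2l// mulrBl mul1r lerD2l lerN2.
by rewrite !expr2 mulrA so ler_wpM2l.
Qed.

(** The radial segments from the trajectory on [[0, b]] to the axis sweep a compact set, so one
    Jacobian bound [C] serves all times and [barrier] applies at level [rbar^2]. *)
Lemma tube_forward_invariant : forward_invariant f (tube R xc rbar).
Proof.
move=> J x Jitv J0 solx Tx0 b Jb b0.
have subJ (t : K) : t \in `[0, b]%R -> J t.
  by rewrite in_itv/= => tb; exact: Jitv tb.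
have xc01 : {within `[0, b], continuous x}.
  apply/subspace_continuousP => t /= tb.
  apply: cvg_trans (solution_within_cvg f J x solx t (subJ t tb)).
  by apply: cvg_app; apply: within_subset => s; exact: subJ.
(* [q (p, s)] moves [p] radially, reaching the axis of the tube at [s = 1]. *)
pose q (z : 'cV[K]_n * K) := z.1 - z.2 *: (R^T *m (R *m (z.1 - xc))).
have qc : continuous q.
  move=> z; have z1 := @cvg_fst _ _ (nbhs z.1) (nbhs z.2) _.
  have z2 := @cvg_snd _ _ (nbhs z.1) (nbhs z.2) _.
  apply: cvgB; first exact: z1.
  apply: cvgZ; first exact: z2.
  apply: (@cvg_mulmx _ _ _ _ _ (nbhs z)).
  apply: (@cvg_mulmx _ _ _ _ _ (nbhs z)).
  by apply: cvgB; [exact: z1|exact: cvg_cst].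
pose A := (x @` `[0, b]) `*` `[(0 : K), 1].
have cA : compact A.
  apply: compact_setX; last exact: segment_compact.
  by apply: continuous_compact => //; exact: segment_compact.
have A0 : A !=set0.
  exists (x 0, 0); split => /=; last by rewrite in_itv/= lexx ler01.
  by exists 0 => //=; rewrite in_itv/= lexx.
have gc : {within A, continuous (fun z => frobenius2 (Jac f (q z)))}.
  apply: continuous_subspaceT => z.
  apply: (@cvg_frobenius2 _ _ _ _ (nbhs z)).
  exact: (cvg_comp q (Jac f) (qc z) (hf.2 (q z))).
have [z0 _ Cmax] := compact_EVT_max A0 cA gc.
pose C := Num.sqrt (frobenius2 (Jac f (q z0))).
pose w t := R *m (x t - xc).
rewrite tubeE /seminorm norm2_le//.
apply: (@barrier _ (fun t => dotp (w t) (w t))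
    (fun t => 2 * dotp (w t) (R *m f (x t))) 0 b _ (2 * C)) => //.
- apply/subspace_continuousP => t tb.
  have xt : x @ within `[0, b] (nbhs t) --> x t.
    by move/subspace_continuousP : xc01; exact.
  have wt : w @ within `[0, b] (nbhs t) --> w t.
    by apply: cvg_mulmx; apply: cvgB => //; exact: cvg_cst.
  exact: cvg_dotp.
- move=> t tb.
  have dx : is_derive t (1 : K) x (f (x t)).
    apply: (solution_is_derive f J x solx).
    near=> s; apply: subJ; apply: subset_itv_oo_cc; near: s.
    exact: near_in_itvoo.
  have dw : is_derive t (1 : K) w (R *m f (x t)).
    apply: is_derive_mulmx; rewrite -[X in is_derive _ _ _ X]subr0.
    exact: is_deriveB.
  apply: is_derive_eq (is_derive_dotp _ _ _ _ _ _ dw dw) _.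
  by rewrite mulr2n mulrDl mul1r.
- move=> t tb wt; rewrite -mulrA ler_pM2l//; apply: outward_velocity_le.
    rewrite -ler_sqr ?nnegrE ?norm2_ge0//; by rewrite norm2_sqr.
  move=> s s01; apply: ler_wsqrtr; apply: (Cmax (x t, s)).
  rewrite inE; split => /=; last by rewrite in_itv.
  by exists t => //; exact: subset_itv_oo_cc.
- by move: Tx0; rewrite tubeE /seminorm norm2_le.
Unshelve. all: by end_near. Qed.

End contraction.

(** * The case of the block matrix [blkR] *)

Lemma blkR_mul_tr {K : realType} {N : nat} (Rt : 'M[K]_(N.-1, N)) :
  Rt *m Rt^T = 1%:M -> blkR Rt *m (blkR Rt)^T = 1%:M.
Proof.
move=> RtRtT; rewrite /blkR tr_block_mx mulmx_block !trmx0 trmx1.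
by rewrite RtRtT !mulmx0 !mul0mx mul1mx !addr0 add0r -scalar_mx_block.
Qed.

Theorem corollary2 (K : realType) (N : nat) (hN : (2 <= N)%N)
    (Rt : 'M[K]_(N.-1, N)) (hRt : orthonormal_complement_ones Rt)
    (f : 'cV[K]_(N + N) -> 'cV[K]_(N + N))
    (hf : continuously_differentiable f)
    (D : set 'cV[K]_(N + N)) (hD : convex_set D)
    (c : K) (hc : 0 < c)
    (hcontr : semi_contracting (blkR Rt) f D c)
    (hker : infinitesimally_invariant (blkR Rt) f D)
    (xc : 'cV[K]_(N + N)) (hxc : D xc)
    (rbar : K) (hrbar : seminorm (blkR Rt) (f xc) / c <= rbar)
    (hT : tube (blkR Rt) xc rbar `<=` D) :
  forward_invariant f (tube (blkR Rt) xc rbar) /\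
  exists xs : 'cV[K]_(N + N),
    [/\ ker_coset (blkR Rt) xs `<=` tube (blkR Rt) xc rbar,
        equilibrium_manifold (blkR Rt) f xs &
        dist_ker (blkR Rt) xc xs <= seminorm (blkR Rt) (f xc) / c].
Proof.
have RRT := blkR_mul_tr Rt hRt.1.
set R := blkR Rt in RRT hcontr hker hrbar hT *.
have contr : semi_contracting R f (tube R xc rbar) c by move=> x /hT; exact: hcontr.
have inv : infinitesimally_invariant R f (tube R xc rbar).
  by move=> x /hT; exact: hker.
split; first exact: (tube_forward_invariant RRT f hf c).
have [w wr Rfw] := projected_equilibrium_exists RRT f hf c rbar xc hc contr inv hrbar.
have Txs v : R *m v = 0 -> seminorm R (xc + R^T *m w + v - xc) = norm2 w.
  move=> Rv; rewrite /seminorm -(addrA xc) (addrC xc) addrK mulmxDr Rv addr0.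
  by rewrite (mulmx_tr RRT).
have coset v : R *m v = 0 -> tube R xc rbar (xc + R^T *m w + v).
  by move=> Rv; rewrite tubeE Txs// (le_trans wr).
exists (xc + R^T *m w); split.
- by move=> _ [v Rv <-]; exact: coset.
- move=> _ [v Rv <-].
  (* The projected field vanishes at [xc + R^T w]; kernel invariance carries this along the whole
     line. *)
  have Tw := coset 0 (mulmx0 _ _); rewrite addr0 in Tw.
  rewrite /seminorm (projected_kernel_invariant f hf rbar xc inv) //.
  by rewrite Rfw norm2E dotp0l sqrtr0.
- rewrite dist_kerE /seminorm opprD addNKr mulmxN (mulmx_tr RRT).
  by rewrite -scaleN1r norm2Z normrN1 mul1r.
Qed.
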